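(* Let $n\ge1$ and let $p$ and $q$ be norms on $E=\mathbb{R}^n$. If $$\mathcal{K}_p^N=\mathcal{K}_q^N\qquad\text{for every integer }N\ge n,$$ then there exists a surjective linear isometry $L:(E,p)\to(E,q)$.
   Context: For a norm $r$ on $E=\mathbb{R}^n$: $B_r=\{x\in E: r(x)\le 1\}$ and $v_r=\mathcal{L}^n(B_r)$ is the Lebesgue measure of $B_r$. For an integer $N\ge n$, let $\mathcal{I}(n,N)$ be the set of increasing $n$-element subsets of $\{1,\dots,N\}$. For a linear map $A:E\to\mathbb{R}^N$ (an $N\times n$ matrix) and $I\in\mathcal{I}(n,N)$, $A_I$ is the $n\times n$ matrix formed by the rows of $A$ indexed by $I$, in increasing order, and $\mathbf{m}(A)=(\det A_I)_{I\in\mathcal{I}(n,N)}\in\mathbb{R}^{\mathcal{I}(n,N)}$. Put $\Pi_r(A)=v_r\,\mathbf{m}(A)$. $A$ is an $r$-contraction if $\|Ax\|_\infty\le r(x)$ for all $x\in E$. Define $$\mathcal{R}_r^N=\{\pm\Pi_r(A): A:E\to\mathbb{R}^N\text{ is an }r\text{-contraction}\},\qquad \mathcal{K}_r^N=\operatorname{conv}(\mathcal{R}_r^N)\subset\mathbb{R}^{\mathcal{I}(n,N)}.$$ *)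

(* Defs.v *)
From HB Require Import structures.
From mathcomp Require Import all_boot all_order all_algebra.
From mathcomp Require Import all_classical all_reals all_analysis.
Set Implicit Arguments.
Unset Strict Implicit.
Unset Printing Implicit Defensive.
Import Order.TTheory GRing.Theory Num.Theory.
Import numFieldNormedType.Exports.
Local Open Scope classical_set_scope.
Local Open Scope ring_scope.

(* Vectors of R^n are column vectors, so that a linear map R^n -> R^N is       *)
(* given by A : 'M_(N, n) acting as x |-> A *m x. Nonnegativity of a norm and  *)
(* its vanishing at 0 follow from the three axioms below.                      *)
Record is_norm (R : realType) (n : nat) (r : 'cV[R]_n -> R) : Prop := IsNorm {
  is_norm_triangle : forall x y, r (x + y) <= r x + r y;
  is_norm_homog : forall (a : R) x, r (a *: x) = `|a| * r x;
  is_norm_definite : forall x, r x = 0 -> x = 0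
}.

Definition unit_ball (R : realType) (n : nat) (r : 'cV[R]_n -> R)
  : set 'cV[R]_n := [set x | r x <= 1].

(* n-dimensional Lebesgue measure as the n-fold product of the library's       *)
(* one-dimensional one, the space R * R^n being identified with R^n.+1 through *)
(* (x, t) |-> x :: t; in dimension 0 it is the unit mass at the empty tuple.   *)
(* product_measure1 is the operation denoted m1 \x m2.                         *)
Fixpoint lebesgue_tuple (R : realType) (n : nat)
    : set (n.-tuple (measurableTypeR R)) -> \bar R :=
  match n with
  | 0 => fun A => (\d_([tuple] : 0.-tuple (measurableTypeR R)) A)%E
  | m.+1 => fun A =>
      product_measure1 (@lebesgue_measure R) (@lebesgue_tuple R m)
        [set u | A (cons_tuple u.1 u.2)]
  end.

Definition lebesgue_col (R : realType) (n : nat) (B : set 'cV[R]_n) : \bar R :=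
  lebesgue_tuple [set t : n.-tuple (measurableTypeR R) |
                   B (\col_(i < n) tnth t i)].

(* The unit ball of a norm has finite measure, so fine loses no information.   *)
Definition ball_volume (R : realType) (n : nat) (r : 'cV[R]_n -> R) : R :=
  fine (lebesgue_col (unit_ball r)).

(* An n-element subset of 'I_N is given by the increasing tuple of its         *)
(* elements.                                                                   *)
Definition incr_index (n N : nat) : finType :=
  {I : n.-tuple 'I_N | sorted ltn (map val I)}.

Definition minors (R : realType) (n N : nat) (A : 'M[R]_(N, n))
  : {ffun incr_index n N -> R^o} :=
  [ffun I : incr_index n N => \det (rowsub (tnth (val I)) A)].

Definition Pi_r (R : realType) (n N : nat) (r : 'cV[R]_n -> R)
    (A : 'M[R]_(N, n)) : {ffun incr_index n N -> R^o} :=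
  ball_volume r *: minors A.

(* mx_norm is the maximum of the absolute values of the entries.               *)
Definition contraction (R : realType) (n N : nat) (r : 'cV[R]_n -> R)
    (A : 'M[R]_(N, n)) : Prop :=
  forall x : 'cV[R]_n, mx_norm (A *m x) <= r x.

Definition R_set (R : realType) (n N : nat) (r : 'cV[R]_n -> R)
  : set {ffun incr_index n N -> R^o} :=
  [set z | exists2 A : 'M[R]_(N, n),
     contraction r A & z = Pi_r r A \/ z = - Pi_r r A].
Arguments R_set {R n} N r.

Definition conv_hull (R : realType) (V : lmodType R) (S : set V) : set V :=
  smallest (@convex_set R V) S.

Definition K_set (R : realType) (n N : nat) (r : 'cV[R]_n -> R)
  : set {ffun incr_index n N -> R^o} :=
  conv_hull (R_set N r).
Arguments K_set {R n} N r.

Definition linear_isometry (R : realType) (n : nat) (p q : 'cV[R]_n -> R)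
    (L : {linear 'cV[R]_n -> 'cV[R]_n}) : Prop :=
  forall x, q (L x) = p x.

(* Main.v *)
Require Import Defs.
From HB Require Import structures.
From mathcomp Require Import all_boot all_order all_algebra.
From mathcomp Require Import all_classical all_reals all_analysis.
From mathcomp Require Import measurable_realfun perm ring lra.
Set Implicit Arguments.
Unset Strict Implicit.
Unset Printing Implicit Defensive.
Import Order.TTheory GRing.Theory Num.Theory.
Import numFieldNormedType.Exports.
(* Makes contraction denote the predicate on matrices again. *)
Import Defs.
Local Open Scope classical_set_scope.
Local Open Scope ring_scope.

(** Write a matrix with n + M rows as A = [F; B], with F square, let b_j be the
    j-th row of B, and let c_1, ..., c_M be vectors of R^n. Cramer's rule
    expresses b_j adj(F) c_j as a combination of the determinants obtained by
    exchanging one row of F for b_j, so for every real L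
      Phi(A) = L det F + sum_j b_j adj(F) c_j
    (test_functional) is a linear functional of the vector of minors m(A).

    The rows of an r-contraction range independently over the dual unit ball of
    r. Hence, when |Phi| is largest among r-contractions, each b_j norms the
    vector adj(F) c_j (norming_functional, a finite dimensional Hahn-Banach
    theorem, provides competitors), and |b_j adj(F) c_j| = r(adj(F) c_j): this
    is maximizer_exchange. A large L also keeps |det F| away from 0
    (maximizer_det), by a bound that does not depend on the c_j.

    Choose a p-contraction A that maximizes |Phi| and, among these, the
    Euclidean norm of m(A). Then v_p m(A), up to sign, is an extreme point of
    the convex hull K_p. As K_p = K_q, and an extreme point of the hull of a set
    belongs to the set, it is also v_q m(A'), up to sign, for a q-contraction
    A' = [G; B'], which maximizes |Phi| for q (lex_max_transfer,
    common_maximizer). So m(A) and m(A') are proportional, every functional of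
    the minors takes proportional values at A and A', and
      p(adj(F) c_j) |det G| = q(adj(G) c_j) |det F|   for all j (finite_match).

    This is one closed condition on (F, G) for each c, finitely many of them can
    be satisfied at once, and (F, G) ranges over a compact set of pairs with
    determinants bounded away from 0. Hence some pair satisfies them for all c,
    and c = F x gives p(x) = q(G^-1 F x). Since v_p
    and v_q are positive and finite (ball_volume_gt0), the vectors of minors can
    be recovered from the points of the hulls. *)

(** * Norms on R^n and norming functionals *)

Section NormBasics.
Variables (R : realType) (n : nat) (r : 'cV[R]_n -> R).
Hypothesis r_norm : is_norm r.

Lemma is_norm0 : r 0 = 0.
Proof. by rewrite -(scale0r 0) is_norm_homog // normr0 mul0r. Qed.

Lemma is_normN x : r (- x) = r x.
Proof. by rewrite -scaleN1r is_norm_homog // normrN1 mul1r. Qed.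

Lemma is_norm_ge0 x : 0 <= r x.
Proof.
have := is_norm_triangle r_norm x (- x).
rewrite subrr is_norm0 is_normN; lra.
Qed.

Lemma is_norm_sum (I : finType) (F : I -> 'cV[R]_n) :
  r (\sum_i F i) <= \sum_i r (F i).
Proof.
elim/big_ind2 : _ => [|x1 y1 x2 y2 le1 le2|//]; first by rewrite is_norm0.
exact: le_trans (is_norm_triangle r_norm _ _) (lerD le1 le2).
Qed.

Lemma is_norm_le_sum_coord x :
  r x <= \sum_i r (delta_mx i 0) * `|x i 0|.
Proof.
have -> : r x = r (\sum_i x i 0 *: delta_mx i 0).
  congr r; rewrite {1}(matrix_sum_delta x).
  by apply: eq_bigr => i _; rewrite big_ord1.
apply: le_trans (is_norm_sum _) _.
by apply: ler_sum => i _; rewrite is_norm_homog // mulrC.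
Qed.

Lemma is_norm_dist x y : `|r x - r y| <= r (x - y).
Proof.
have := is_norm_triangle r_norm (x - y) y.
have := is_norm_triangle r_norm (y - x) x.
rewrite !subrK -opprB is_normN ler_norml => h1 h2.
by apply/andP; split; lra.
Qed.

End NormBasics.

Definition sublinear (R : realType) (V : lmodType R) (s : V -> R) : Prop :=
  (forall x y, s (x + y) <= s x + s y) /\
  (forall (t : R) x, 0 <= t -> s (t *: x) = t * s x).

Section HahnBanach.
Variables (R : realType) (V : lmodType R).
Implicit Types (s : V -> R) (x y a : V).

Lemma sublinear0 s : sublinear s -> s 0 = 0.
Proof. by case=> _ h; rewrite -(scale0r (0 : V)) h // mul0r. Qed.

Lemma sublinear_ge_opp s x : sublinear s -> - s x <= s (- x).
Proof.
move=> hs; have := hs.1 x (- x); rewrite subrr sublinear0 //; lra.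
Qed.

(** The largest sublinear minorant of s whose value at - a is at most - s a:
    it makes s linear along the line of a without changing s a. *)
Definition flatten_along s a x : R :=
  inf [set s (x + t *: a) - t * s a | t in [set t : R | 0 <= t]].

(** The infimum is finite because t * s a <= s (x + t *: a) + s (- x). *)
Lemma flatten_along_lbound s a x (t : R) : sublinear s -> 0 <= t ->
  flatten_along s a x <= s (x + t *: a) - t * s a.
Proof.
move=> hs t0; apply: ge_inf; last by exists t.
exists (- s (- x)) => _ [u /= u0 <-].
have := hs.1 (x + u *: a) (- x).
by rewrite addrC addKr hs.2 //; lra.
Qed.

Lemma flatten_along_glb s a x (m : R) : sublinear s ->
  (forall t, 0 <= t -> m <= s (x + t *: a) - t * s a) ->
  m <= flatten_along s a x.
Proof.
move=> hs h; apply: lb_le_inf.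
  by exists (s (x + 0 *: a) - 0 * s a); exists 0 => //=.
by move=> _ [t /= t0 <-]; exact: h.
Qed.

Lemma flatten_along_le s a x : sublinear s -> flatten_along s a x <= s x.
Proof.
move=> hs; apply: le_trans (flatten_along_lbound a x hs (lexx 0)) _.
by rewrite scale0r addr0 mul0r subr0.
Qed.

Lemma flatten_along_opp s a : sublinear s -> flatten_along s a (- a) <= - s a.
Proof.
move=> hs; apply: le_trans (flatten_along_lbound a (- a) hs ler01) _.
by rewrite scale1r addNr sublinear0 // mul1r sub0r.
Qed.

Lemma flatten_along_sublinear s a :
  sublinear s -> sublinear (flatten_along s a).
Proof.
move=> hs; split=> [x y|t x].
  rewrite -lerBlDl; apply: flatten_along_glb => // u u0.
  rewrite lerBlDl -lerBlDr; apply: flatten_along_glb => // v v0.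
  have := flatten_along_lbound a (x + y) hs (addr_ge0 u0 v0).
  have := hs.1 (x + v *: a) (y + u *: a).
  have -> : x + v *: a + (y + u *: a) = x + y + (u + v) *: a.
    by rewrite scalerDl addrACA [v *: a + _]addrC.
  by lra.
rewrite le_eqVlt => /predU1P[<-|t0].
  rewrite scale0r mul0r; apply/eqP; rewrite eq_le; apply/andP; split.
    by have := flatten_along_le a 0 hs; rewrite (sublinear0 hs).
  apply: flatten_along_glb => // u u0.
  by rewrite add0r hs.2 // subrr.
have scale_le (u : R) y : 0 < u ->
    u * flatten_along s a y <= flatten_along s a (u *: y).
  move=> u0; apply: flatten_along_glb => // v v0.
  have vu0 : 0 <= v / u by rewrite divr_ge0 // ltW.
  have := flatten_along_lbound a y hs vu0.
  rewrite -(ler_pM2l u0) => /le_trans; apply.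
  have uvu : u * (v / u) = v by rewrite mulrC divfK ?gt_eqF.
  by rewrite mulrBr -(hs.2 u _ (ltW u0)) scalerDr scalerA [u * (_ * s a)]mulrA uvu.
apply/eqP; rewrite eq_le scale_le // andbT.
have t'0 : 0 < t^-1 by rewrite invr_gt0.
have := scale_le _ (t *: x) t'0.
by rewrite scalerA mulVf ?gt_eqF // scale1r ler_pdivrMl.
Qed.

(** Flattening along a later vector does not undo an earlier one: if
    s (- a) <= - s a, then any sublinear s' below s satisfies
    - s a <= - s' a <= s' (- a) <= s (- a) <= - s a. *)
Lemma sublinear_flat_on s (l : seq V) : sublinear s ->
  exists s', [/\ sublinear s', forall x, s' x <= s x &
    forall a, a \in l -> s' (- a) <= - s' a].
Proof.
elim: l s => [|a l IHl] s hs; first by exists s; split=> // x.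
have [s' [hs' les' flat']] := IHl _ (flatten_along_sublinear a hs).
exists s'; split=> // [x|b].
  exact: le_trans (les' x) (flatten_along_le a x hs).
rewrite inE => /predU1P[->|]; last exact: flat'.
have h1 := les' (- a); have h2 := les' a.
have h3 := flatten_along_opp a hs; have h4 := flatten_along_le a a hs.
by lra.
Qed.

End HahnBanach.

(** The norm is first flattened along x, which keeps its value at x, and then
    along the canonical basis, after which it is linear. *)
Lemma norming_functional (R : realType) (n : nat) (r : 'cV[R]_n -> R) x :
  is_norm r -> exists b : 'rV[R]_n,
    (b *m x) 0 0 = r x /\ forall y, `|(b *m y) 0 0| <= r y.
Proof.
move=> rn.
have hr : sublinear r.
  split=> [y z|t y t0]; first exact: is_norm_triangle.
  by rewrite is_norm_homog // ger0_norm.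
have hs := flatten_along_sublinear x hr.
have [f [hf lef flatf]] :=
  sublinear_flat_on [seq delta_mx i 0 | i <- enum 'I_n] hs.
have lefr y : f y <= r y by apply: le_trans (lef y) (flatten_along_le x y hr).
pose b : 'rV[R]_n := \row_i f (delta_mx i 0).
have fscale (t : R) i : f (t *: delta_mx i 0) <= t * f (delta_mx i 0).
  have [t0|t0] := leP 0 t; first by rewrite hf.2.
  have ti0 : 0 <= - t by lra.
  have -> : t *: delta_mx i 0 = (- t) *: (- delta_mx i 0) :> 'cV[R]_n.
    by rewrite scaleNr scalerN opprK.
  rewrite hf.2 // -[leRHS]mulrNN ler_wpM2l //; apply: flatf.
  by apply/mapP; exists i => //; rewrite mem_enum.
have fb y : f y <= (b *m y) 0 0.
  have sum_le (I : seq 'I_n) :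
      f (\sum_(i <- I) y i 0 *: delta_mx i 0) <=
      \sum_(i <- I) y i 0 * f (delta_mx i 0).
    elim: I => [|i I IHI]; first by rewrite !big_nil sublinear0.
    rewrite !big_cons; apply: le_trans (hf.1 _ _) _.
    by rewrite lerD.
  have -> : f y = f (\sum_i y i 0 *: delta_mx i 0).
    congr f; rewrite {1}(matrix_sum_delta y).
    by apply: eq_bigr => i _; rewrite big_ord1.
  apply: le_trans (sum_le _) _; rewrite mxE.
  by apply: ler_sum => i _; rewrite mxE mulrC.
have bN y : (b *m - y) 0 0 = - (b *m y) 0 0 by rewrite mulmxN mxE.
have bf y : (b *m y) 0 0 <= f y.
  have := fb (- y); rewrite bN; have := sublinear_ge_opp (- y) hf.
  by rewrite opprK; lra.
exists b; split=> [|y].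
  have h1 := lef (- x); have h2 := flatten_along_opp x hr.
  have h3 := fb (- x); have h4 := bf (- x).
  have h5 := lefr x; have h6 := fb x; have h7 := bf x.
  by move: h3 h4; rewrite !bN; lra.
rewrite ler_norml; apply/andP; split; last exact: le_trans (bf y) (lefr y).
have := le_trans (bf (- y)) (lefr (- y)).
by rewrite bN is_normN //; lra.
Qed.

(** * Continuity and compactness for matrices *)

Section CoordinateContinuity.
Variables (R : realType) (T : topologicalType).
Implicit Types f g : T -> R.

Lemma continuous_bigsum (I : Type) (s : seq I) (F : I -> T -> R) :
  (forall i, continuous (F i)) -> continuous (fun x => \sum_(i <- s) F i x).
Proof.
move=> cF; apply: (@continuous_big R I +%R 0 xpredT) => [|i _]; last exact: cF.
exact: (@add_continuous R^o).
Qed.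

Lemma continuous_bigprod (I : Type) (s : seq I) (F : I -> T -> R) :
  (forall i, continuous (F i)) -> continuous (fun x => \prod_(i <- s) F i x).
Proof.
move=> cF; apply: (@continuous_big R I *%R 1 xpredT) => [|i _]; last exact: cF.
exact: mul_continuous.
Qed.

Lemma continuous_mul f g :
  continuous f -> continuous g -> continuous (fun x => f x * g x).
Proof. by move=> cf cg x; apply: cvgM; [exact: cf | exact: cg]. Qed.

Lemma continuous_opp f : continuous f -> continuous (fun x => - f x).
Proof. by move=> cf x; apply: (@cvgN R R^o); exact: cf. Qed.

Lemma continuous_abs f : continuous f -> continuous (fun x => `|f x|).
Proof. by move=> cf x; apply: (@cvg_norm R R^o); exact: cf. Qed.

Lemma continuous_const (a : R) : continuous (fun _ : T => a).
Proof. by move=> x; exact: cvg_cst. Qed.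

(** Continuity of a matrix valued function, tested on entries: a form
    that passes through products and adjugates directly from their formulas. *)
Definition continuous_entries m n (F : T -> 'M[R]_(m, n)) : Prop :=
  forall i j, continuous (fun x => F x i j).

Lemma continuous_det n (F : T -> 'M[R]_n) :
  continuous_entries F -> continuous (fun x => \det (F x)).
Proof.
move=> cF; apply: continuous_bigsum => s.
apply: continuous_mul; first exact: continuous_const.
by apply: continuous_bigprod => i; exact: cF.
Qed.

Lemma continuous_adj n (F : T -> 'M[R]_n) :
  continuous_entries F -> continuous_entries (fun x => \adj (F x)).
Proof.
move=> cF i j; under eq_fun => x do rewrite mxE.
apply: continuous_mul; first exact: continuous_const.
apply: continuous_det => k l; under eq_fun => x do rewrite !mxE.
exact: cF.
Qed.

Lemma continuous_mulmx m n k (F : T -> 'M[R]_(m, n)) (G : T -> 'M[R]_(n, k)) :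
  continuous_entries F -> continuous_entries G ->
  continuous_entries (fun x => F x *m G x).
Proof.
move=> cF cG i j; under eq_fun => x do rewrite mxE.
by apply: continuous_bigsum => l; apply: continuous_mul; [exact: cF | exact: cG].
Qed.

Lemma is_norm_continuous n (r : 'cV[R]_n -> R) (F : T -> 'cV[R]_n) :
  is_norm r -> continuous_entries F -> continuous (fun x => r (F x)).
Proof.
move=> rn cF x.
pose d y := \sum_i r (delta_mx i 0) * `|F x i 0 - F y i 0|.
have d0 : d y @[y --> x] --> 0.
  have -> : 0 = d x by rewrite /d big1 // => i _; rewrite subrr normr0 mulr0.
  apply: continuous_bigsum => i; apply: continuous_mul.
    exact: continuous_const.
  apply: continuous_abs => y; apply: (@cvgB R R^o); first exact: cvg_cst.
  exact: cF.
apply/(@cvgrPdist_le R R^o) => e e0.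
move/(@cvgrPdist_le R R^o) : d0 => /(_ e e0).
apply: filterS => y; rewrite sub0r normrN => le_de.
apply: le_trans (is_norm_dist rn _ _) _.
apply: le_trans (is_norm_le_sum_coord rn _) _.
apply: le_trans le_de; apply: le_trans (ler_norm _).
by apply: ler_sum => i _; rewrite !mxE.
Qed.

End CoordinateContinuity.

Lemma continuous_entries_id (R : realType) m n :
  continuous_entries (fun A : 'M[R]_(m, n) => A).
Proof. by move=> i j; exact: coord_continuous. Qed.

Lemma continuous_vec_mx (R : realType) m n :
  continuous (@vec_mx R m n : 'rV[R]_(m * n) -> 'M[R]_(m, n)).
Proof.
move=> v A [P nbhsP subA].
suff : \forall w \near v, forall i j, P i j (vec_mx w i j).
  by apply: (@filterS _ (nbhs v)) => w Pw; exact: subA.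
have nbhsF : Filter (nbhs v) by exact: nbhs_filter.
apply: (@filter_forall _ _ (fun i w => forall j, P i j (vec_mx w i j)) _ nbhsF).
move=> i; apply: (@filter_forall _ _ (fun j w => P i j (vec_mx w i j)) _ nbhsF).
move=> j.
have := @coord_continuous R _ _ 0 (mxvec_index i j) v.
have := nbhsP i j; rewrite mxE => nP /(_ _ nP).
by apply: (@filterS _ (nbhs v) nbhsF) => w /=; rewrite mxE.
Qed.

(** The box is the image under vec_mx of a product of segments. *)
Lemma compact_mx_box (R : realType) m n (C : R) :
  compact [set A : 'M[R]_(m, n) | forall i j, `|A i j| <= C].
Proof.
pose box := [set v : 'rV[R]_(m * n) | forall k, `[- C, C]%classic (v 0 k)].
have box_compact : compact box.
  by apply: (@rV_compact R _ (fun=> `[- C, C]%classic)) => _;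
     exact: segment_compact.
have -> : [set A : 'M[R]_(m, n) | forall i j, `|A i j| <= C] = vec_mx @` box.
  apply/seteqP; split=> [A bA|_ [v bv <-] i j] /=.
    exists (mxvec A); last exact: mxvecK.
    move=> k; case/mxvec_indexP: k => i j.
    by rewrite /= mxvecE in_itv /= -ler_norml.
  by rewrite mxE ler_norml; have := bv (mxvec_index i j); rewrite /= in_itv.
apply: continuous_compact => //; apply: continuous_subspaceT.
exact: continuous_vec_mx.
Qed.

Lemma closed_le_continuous (R : realType) (T : topologicalType) (f g : T -> R) :
  continuous f -> continuous g -> closed [set x | f x <= g x].
Proof.
move=> cf cg.
have -> : [set x | f x <= g x] = (fun x => g x - f x) @^-1` [set t | 0 <= t].
  by apply/seteqP; split=> x /=; rewrite subr_ge0.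
apply: preimage_closed; last exact: closed_ge.
by move=> x _; apply: (@cvgB R R^o); [exact: cg | exact: cf].
Qed.

Lemma closed_eq_continuous (R : realType) (T : topologicalType) (f g : T -> R) :
  continuous f -> continuous g -> closed [set x | f x = g x].
Proof.
move=> cf cg.
have -> : [set x | f x = g x] = [set x | f x <= g x] `&` [set x | g x <= f x].
  apply/seteqP; split=> x /= => [->|[le1 le2]]; first by rewrite lexx.
  by apply/eqP; rewrite eq_le le1 le2.
by apply: closedI; exact: closed_le_continuous.
Qed.

Lemma compact_finite_intersection (T : topologicalType) (I : eqType) (K : set T)
    (E : I -> set T) :
  compact K -> (forall i, closed (E i)) ->
  (forall s : seq I, exists2 x, K x & forall i, i \in s -> E i x) ->
  exists2 x, K x & forall i, E i x.
Proof.
move=> cK Ecl fin; pose B (s : seq I) := K `&` [set x | forall i, i \in s -> E i x].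
have FF : ProperFilter (filter_from setT B).
  apply: filter_from_proper => [|s _]; last first.
    by have [x Kx Ex] := fin s; exists x.
  apply: filter_from_filter => [|s t _ _]; first by exists [::].
  exists (s ++ t) => // x [Kx Ex].
  by split; split=> // i iin; apply: Ex; rewrite mem_cat iin ?orbT.
have [|x [Kx clx]] := cK _ FF; first by exists [::] => // x [].
exists x => // i; apply: Ecl => V xV.
have BE : filter_from setT B (E i).
  by exists [:: i] => // y [_]; apply; rewrite mem_head.
exact: clx BE xV.
Qed.

Lemma compact_max (R : realType) (T : topologicalType) (K : set T) (f : T -> R) :
  K !=set0 -> compact K -> continuous f ->
  exists2 x, K x & forall y, K y -> f y <= f x.
Proof.
move=> K0 cK cf.
have [|x /set_mem Kx xmax] := compact_EVT_max K0 cK (f := f).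
  exact: continuous_subspaceT.
by exists x => // y Ky; apply: xmax; exact: mem_set.
Qed.

(** The points where f is maximal form a compact set, on which g is maximized
    in turn. *)
Lemma compact_lex_max (R : realType) (T : topologicalType) (K : set T)
    (f g : T -> R) :
  K !=set0 -> compact K -> continuous f -> continuous g ->
  exists x, [/\ K x, forall y, K y -> f y <= f x &
    forall y, K y -> f y = f x -> g y <= g x].
Proof.
move=> K0 cK cf cg; have [a Ka amax] := compact_max K0 cK cf.
pose L := K `&` [set x | f x = f a].
have cL : compact L.
  apply: compact_closedI => //; apply: closed_eq_continuous => //.
  exact: continuous_const.
have [|x [Kx /= fx] xmax] := compact_max (K := L) _ cL cg.
  by exists a; split.
exists x; split=> // y Ky; first by rewrite fx; exact: amax.
by rewrite fx => fy; apply: xmax.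
Qed.

(** The constant is the minimum of r on the sphere of the maximum norm. *)
Lemma is_norm_lower_bound (R : realType) n (r : 'cV[R]_n -> R) : is_norm r ->
  exists2 t : R, 0 < t & forall (x : 'cV[R]_n) i, t * `|x i 0| <= r x.
Proof.
move=> rn; pose S := [set x : 'cV[R]_n | `|x| = 1].
have [S0|/set0P S0] := eqVneq S set0.
  (* The sphere is empty only in dimension 0. *)
  exists 1 => // x i; have [->|x0] := eqVneq x 0.
    by rewrite mxE normr0 mulr0 is_norm0.
  have : S (`|x|^-1 *: x).
    by rewrite /S /= normrZ normfV normr_id mulVf ?normr_eq0.
  by rewrite S0.
have coord_le (x : 'cV[R]_n) i : `|x i 0| <= `|x|.
  by rewrite [leRHS]/Num.Def.normr /= mx_normrE; apply/bigmax_geP; right;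
     exists (i, 0).
have cS : compact S.
  apply: (subclosed_compact _ (@compact_mx_box R n 1 1)).
    apply: closed_eq_continuous; last exact: continuous_const.
    exact: norm_continuous.
  by move=> x Sx i j; rewrite ord1 -Sx; exact: coord_le.
have cr : continuous (fun x => - r x).
  apply: continuous_opp.
  exact: (is_norm_continuous rn (@continuous_entries_id R n 1)).
have [x0 Sx0 x0min] := compact_max S0 cS cr.
have rx0 : 0 < r x0.
  rewrite lt_neqAle is_norm_ge0 // andbT eq_sym; apply/eqP.
  move/(is_norm_definite rn) => x00.
  by move: Sx0; rewrite /S /= x00 normr0 => /eqP; rewrite eq_sym oner_eq0.
exists (r x0) => // x i; have [->|xN0] := eqVneq x 0.
  by rewrite mxE normr0 mulr0 is_norm0.
have nx : 0 < `|x| by rewrite normr_gt0.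
have : S (`|x|^-1 *: x).
  by rewrite /S /= normrZ normfV normr_id mulVf ?normr_eq0.
move/x0min; rewrite lerN2 is_norm_homog // normfV normr_id.
rewrite ler_pdivlMl // mulrC; apply: le_trans.
by rewrite ler_wpM2l // is_norm_ge0.
Qed.

(** * Linear functionals of the minors *)

Section Pairing.
Variables (R : realType) (J : finType).
Implicit Types (a : R) (l z : {ffun J -> R^o}).

Definition pairing l z : R := \sum_i l i * z i.

Lemma pairingC l z : pairing l z = pairing z l.
Proof. by apply: eq_bigr => i _; rewrite mulrC. Qed.

Lemma pairingDr l z1 z2 : pairing l (z1 + z2) = pairing l z1 + pairing l z2.
Proof. by rewrite -big_split; apply: eq_bigr => i _; rewrite ffunE mulrDr. Qed.

Lemma pairingZr l a z : pairing l (a *: z) = a * pairing l z.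
Proof.
by rewrite big_distrr; apply: eq_bigr => i _ /=; rewrite ffunE mulrCA.
Qed.

Lemma pairingDl l1 l2 z : pairing (l1 + l2) z = pairing l1 z + pairing l2 z.
Proof. by rewrite pairingC pairingDr !(pairingC z). Qed.

Lemma pairingZl a l z : pairing (a *: l) z = a * pairing l z.
Proof. by rewrite pairingC pairingZr pairingC. Qed.

Lemma pairing_ge0 z : 0 <= pairing z z.
Proof. by apply: sumr_ge0 => i _; rewrite -expr2 sqr_ge0. Qed.

Lemma pairing_eq0 z : pairing z z = 0 -> z = 0.
Proof.
move/eqP; rewrite psumr_eq0 => [/allP z0|i _]; last by rewrite -expr2 sqr_ge0.
apply/ffunP => i; have := z0 i; rewrite mem_index_enum => /(_ isT) /=.
by rewrite -expr2 sqrf_eq0 ffunE => /eqP.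
Qed.

(** Strict convexity of the squared Euclidean norm, with its exact defect. *)
Lemma pairing_conv (t : R) x y :
  pairing (t *: x + (1 - t) *: y) (t *: x + (1 - t) *: y) =
  t * pairing x x + (1 - t) * pairing y y -
  t * (1 - t) * pairing (x - y) (x - y).
Proof.
rewrite -(scaleN1r y) !(pairingDl, pairingDr, pairingZl, pairingZr).
by rewrite (pairingC y x); ring.
Qed.

End Pairing.

Section MinorFunctionals.
Variables (R : realType) (n N : nat).
Implicit Types (phi psi : 'M[R]_(N, n) -> R).

(** The linear functionals on the space of vectors of minors, seen as functions
    of the matrix. *)
Definition minor_functional phi : Prop :=
  exists l, forall A, phi A = pairing l (minors A).

Lemma minor_functional_add phi psi :
  minor_functional phi -> minor_functional psi ->
  minor_functional (fun A => phi A + psi A).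
Proof.
by move=> [l hl] [k hk]; exists (l + k) => A; rewrite hl hk pairingDl.
Qed.

Lemma minor_functional_scale (a : R) phi :
  minor_functional phi -> minor_functional (fun A => a * phi A).
Proof. by move=> [l hl]; exists (a *: l) => A; rewrite hl pairingZl. Qed.

Lemma minor_functional_sum (J : finType) (phi : J -> 'M[R]_(N, n) -> R) :
  (forall j, minor_functional (phi j)) ->
  minor_functional (fun A => \sum_j phi j A).
Proof.
move=> /choice [l hl]; exists (\sum_j l j) => A.
rewrite /pairing; under eq_bigr => j _ do rewrite hl.
rewrite exchange_big; apply: eq_bigr => I _.
by rewrite -mulr_suml sum_ffunE.
Qed.

(** Only increasing selections of rows are coordinates of minors A; any other
    selection either repeats a row, and has determinant 0, or is a permutation
    of an increasing one. *)
Lemma minor_functional_rowsub (g : 'I_n -> 'I_N) :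
  minor_functional (fun A => \det (rowsub g A)).
Proof.
have [ginj|/injectivePn [i1 [i2 i12 gi12]]] := boolP (injectiveb g); last first.
  exists 0 => A; rewrite (determinant_alternate i12) => [|j].
    by rewrite /pairing big1 // => I _; rewrite ffunE mul0r.
  by rewrite !mxE gi12.
pose t : n.-tuple 'I_N := [tuple g i | i < n].
pose s : n.-tuple 'I_N := sort_tuple (relpre val leq) t.
have s_incr : sorted ltn (map val s).
  rewrite ltn_sorted_uniq_leq; apply/andP; split.
    rewrite map_inj_uniq ?sort_uniq; last exact: val_inj.
    by rewrite map_inj_uniq ?enum_uniq //; exact/injectiveP.
  by rewrite sorted_map; apply: sort_sorted => x y; exact: leq_total.
have /tuple_permP [u tu] : perm_eq t s by rewrite perm_sym perm_sort.
have gE i : g i = tnth s (u i).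
  have /val_inj tu' : val t = val [tuple tnth s (u i) | i < n] by [].
  by rewrite -(tnth_mktuple (fun i => tnth s (u i))) -tu' tnth_mktuple.
pose I0 : incr_index n N := exist _ s s_incr.
exists [ffun I => if I == I0 then (-1) ^+ u else 0] => A.
rewrite /pairing (bigD1 I0) //= big1 ?addr0 => [|I /negbTE II0]; last first.
  by rewrite ffunE II0 mul0r.
rewrite !ffunE eqxx -det_perm -det_mulmx -row_permE; congr (\det _).
by apply/matrixP => i j; rewrite !mxE gE.
Qed.

Lemma minor_functional_prop phi (A B : 'M[R]_(N, n)) (k : R) :
  minor_functional phi -> minors A = k *: minors B -> phi A = k * phi B.
Proof. by move=> [l hl] AB; rewrite !hl AB pairingZr. Qed.

End MinorFunctionals.

Section Exchange.
Variables (R : realType) (n M : nat).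
Implicit Types A : 'M[R]_(n + M, n).

Lemma minor_functional_top :
  minor_functional (fun A => \det (usubmx A)).
Proof.
have [l hl] := minor_functional_rowsub R (@lshift n M).
exists l => A; rewrite -hl; congr (\det _).
by apply/matrixP => i j; rewrite !mxE.
Qed.

(** With F the top block of A and b the j-th row below it, this is
    b adj(F) c = sum_i c_i det (F with row i exchanged for b). *)
Definition exchange (c : 'cV[R]_n) (j : 'I_M) A : R :=
  (row j (dsubmx A) *m (\adj (usubmx A) *m c)) 0 0.

(** Expanding along the row i that holds b, the cofactors are those of F. *)
Lemma minor_functional_exchange c j : minor_functional (exchange c j).
Proof.
pose g (i k : 'I_n) := if k == i then rshift n j else lshift M k.
have [l hl] := minor_functional_sum (fun i =>
  minor_functional_scale (c i 0) (minor_functional_rowsub R (g i))).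
exists l => A; rewrite -hl /exchange mulmxA mxE; apply: eq_bigr => i _.
rewrite mulrC; congr (_ * _); rewrite (expand_det_row _ i) mxE.
apply: eq_bigr => k _; rewrite !mxE /g eqxx; congr (_ * _).
congr (_ * \det _); apply/matrixP => a b; rewrite !mxE.
by rewrite eq_sym (negbTE (neq_lift _ _)).
Qed.

Definition test_functional (L : R) (c : 'I_M -> 'cV[R]_n) A : R :=
  L * \det (usubmx A) + \sum_j exchange (c j) j A.

Lemma minor_functional_test L c : minor_functional (test_functional L c).
Proof.
apply: minor_functional_add.
  exact/minor_functional_scale/minor_functional_top.
by apply: minor_functional_sum => j; exact: minor_functional_exchange.
Qed.

End Exchange.

(** * Contractions *)

Section Contractions.
Variables (R : realType) (n : nat) (r : 'cV[R]_n -> R).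
Hypothesis r_norm : is_norm r.

Lemma contractionP N (A : 'M[R]_(N, n)) :
  contraction r A <-> forall i x, `|(A *m x) i 0| <= r x.
Proof.
split=> [cA i x|cA x].
  apply: le_trans (cA x); rewrite mx_normrE.
  by apply/bigmax_geP; right; exists (i, 0).
rewrite mx_normrE; apply: bigmax_le; first exact: is_norm_ge0.
by move=> [i j] _ /=; rewrite ord1; exact: cA.
Qed.

(** The j-th column of a contraction is the image of the j-th basis vector,
    whose entries are at most the norm of that vector. *)
Lemma compact_contraction N : compact [set A : 'M[R]_(N, n) | contraction r A].
Proof.
pose C := \sum_i r (delta_mx i 0).
apply: (subclosed_compact _ (@compact_mx_box R N n C)); last first.
  move=> A /contractionP cA i j /=.
  have -> : A i j = (A *m (delta_mx j 0 : 'cV_n)) i 0.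
    rewrite mxE (bigD1 j) //= big1 ?addr0 => [|k /negbTE kj].
      by rewrite mxE !eqxx mulr1.
    by rewrite mxE kj mulr0.
  apply: le_trans (cA _ _) _; rewrite /C (bigD1 j) //= lerDl.
  by apply: sumr_ge0 => k _; exact: is_norm_ge0.
have -> : [set A : 'M[R]_(N, n) | contraction r A] =
    \bigcap_(ix in [set: 'I_N * 'cV[R]_n])
      [set A | `|(A *m ix.2) ix.1 0| <= r ix.2].
  apply/seteqP; split=> A /= => [/contractionP cA [i x] _ /=|cA]; first exact: cA.
  by apply/contractionP => i x; exact: (cA (i, x)).
apply: closed_bigI => -[i x] _ /=.
apply: closed_le_continuous; last exact: continuous_const.
apply: continuous_abs; apply: continuous_mulmx => [|k l].
  exact: continuous_entries_id.
exact: continuous_const.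
Qed.

Lemma contraction0 N : contraction r (0 : 'M[R]_(N, n)).
Proof.
by apply/contractionP => i x; rewrite mul0mx mxE normr0 is_norm_ge0.
Qed.

Lemma contraction_top m1 m2 (A : 'M[R]_(m1 + m2, n)) :
  contraction r A -> contraction r (usubmx A).
Proof.
move/contractionP=> cA; apply/contractionP => i x.
by have := cA (lshift m2 i) x; rewrite -[A in A *m x]vsubmxK mul_col_mx col_mxEu.
Qed.

Lemma contraction_col_mx m1 m2 (F : 'M[R]_(m1, n)) (B : 'M[R]_(m2, n)) :
  contraction r F -> contraction r B -> contraction r (col_mx F B).
Proof.
move=> /contractionP cF /contractionP cB; apply/contractionP => i x.
rewrite mul_col_mx mxE; case: splitP => k _; [exact: cF | exact: cB].
Qed.

Lemma contraction_scalar : exists2 t : R, 0 < t & contraction r (t%:M : 'M[R]_n).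
Proof.
have [t t0 ht] := is_norm_lower_bound r_norm.
exists t => //; apply/contractionP => i x.
by rewrite mul_scalar_mx mxE normrM gtr0_norm.
Qed.

Lemma exchange_le M (c : 'cV[R]_n) (j : 'I_M) (A : 'M[R]_(n + M, n)) :
  contraction r A -> `|exchange c j A| <= r (\adj (usubmx A) *m c).
Proof.
move/contractionP=> cA; set x := _ *m c.
have := cA (rshift n j) x.
rewrite -[A in A *m x]vsubmxK mul_col_mx col_mxEd.
by rewrite /exchange -/x -row_mul [row _ _ 0 0]mxE.
Qed.

End Contractions.

(** * Contractions at which a test functional is extremal *)

Section Maximizers.
Variables (R : realType) (n M : nat) (r : 'cV[R]_n -> R).
Variables (L d : R) (c : 'I_M -> 'cV[R]_n) (F0 : 'M[R]_n).
Hypothesis r_norm : is_norm r.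
Hypothesis F0_contr : contraction r F0.
Hypothesis d_gt0 : 0 < d.
Hypothesis L_gt0 : 0 < L.
Hypothesis det_F0 : d <= `|\det F0|.
Hypothesis L_large : forall F : 'M[R]_n, contraction r F ->
  \sum_j r (\adj F *m c j) <= L * (d / 2).

Definition is_maximizer (A : 'M[R]_(n + M, n)) : Prop :=
  contraction r A /\ forall B, contraction r B ->
    `|test_functional L c B| <= `|test_functional L c A|.

(** Compare A with [F0; 0], where the functional is L det F0: the exchange terms
    of A contribute at most half of L d. *)
Lemma maximizer_det A : is_maximizer A -> d / 2 <= `|\det (usubmx A)|.
Proof.
move=> [cA maxA]; have := maxA (col_mx F0 0) _.
move/(_ (contraction_col_mx r_norm F0_contr (contraction0 r_norm M))).
rewrite {1}/test_functional col_mxKu big1 ?addr0 => [|j _]; last first.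
  by rewrite /exchange col_mxKd row0 mul0mx mxE.
rewrite normrM gtr0_norm // => le1.
have le2 : `|test_functional L c A| <= L * `|\det (usubmx A)| + L * (d / 2).
  apply: le_trans (ler_normD _ _) _; rewrite normrM gtr0_norm // lerD2l.
  apply: le_trans (ler_norm_sum _ _ _) _.
  apply: le_trans (L_large (contraction_top r_norm cA)).
  by apply: ler_sum => j _; exact: exchange_le.
have le3 : L * d <= L * `|\det F0| by rewrite ler_pM2l.
have : L * d <= L * (`|\det (usubmx A)| + d / 2).
  by rewrite mulrDr; apply: le_trans le3 (le_trans le1 le2).
by rewrite ler_pM2l //; lra.
Qed.

(** Keep the top block F of A and replace the rows below by norming functionals
    of the vectors adj(F) c_j, with the sign of det F: the test functional then
    has absolute value L |det F| + sum_j r(adj(F) c_j), an upper bound for it on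
    all contractions with top block F, reached only if every term is
    extremal. *)
Lemma maximizer_exchange A j : is_maximizer A ->
  exchange (c j) j A =
  Num.sg (\det (usubmx A)) * r (\adj (usubmx A) *m c j).
Proof.
move=> maxA; have detF := maximizer_det maxA; case: maxA => cA maxA.
set F := usubmx A; set e := Num.sg (\det F).
have detF0 : \det F != 0.
  by rewrite -normr_gt0; apply: lt_le_trans detF; rewrite divr_gt0.
have ee : e * e = 1 by rewrite -expr2 sqr_sg detF0.
have norm_e : `|e| = 1 by rewrite normr_sg detF0.
pose x k := \adj F *m c k.
have /choice [b hb] : forall k, exists b : 'rV[R]_n,
    (b *m x k) 0 0 = r (x k) /\ forall y, `|(b *m y) 0 0| <= r y.
  by move=> k; exact: norming_functional.
pose B : 'M[R]_(M, n) := \matrix_k (e *: b k).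
have rowB k : row k B = e *: b k by rewrite rowK.
have cB : contraction r B.
  apply/(contractionP r_norm) => k y.
  have -> : (B *m y) k 0 = (row k B *m y) 0 0 by rewrite -row_mul [RHS]mxE.
  by rewrite rowB -scalemxAl mxE normrM norm_e mul1r; case: (hb k).
have := maxA _ (contraction_col_mx r_norm (contraction_top r_norm cA) cB).
pose P := \sum_k r (x k); pose S := \sum_k e * exchange (c k) k A.
have -> : test_functional L c (col_mx F B) = e * (L * `|\det F| + P).
  rewrite /test_functional col_mxKu mulrDr mulrCA -numEsg; congr (_ + _).
  rewrite mulr_sumr; apply: eq_bigr => k _.
  rewrite /exchange col_mxKu col_mxKd rowB -scalemxAl mxE.
  by case: (hb k) => ->.
have -> : test_functional L c A = e * (L * `|\det F| + S).
  rewrite /test_functional mulrDr mulrCA -numEsg; congr (_ + _).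
  by rewrite mulr_sumr; apply: eq_bigr => k _; rewrite mulrA ee mul1r.
have Dpos : 0 < L * `|\det F| by rewrite mulr_gt0 // normr_gt0.
have term_le k : e * exchange (c k) k A <= r (x k).
  apply: le_trans (ler_norm _) _; rewrite normrM norm_e mul1r.
  exact: exchange_le.
have term_ge k : - r (x k) <= e * exchange (c k) k A.
  rewrite -lerN2 opprK; apply: le_trans (ler_norm _) _.
  rewrite normrN normrM norm_e mul1r; exact: exchange_le.
have SP : S <= P by exact: ler_sum.
have PS : - P <= S by rewrite /P -sumrN; exact: ler_sum.
have P0 : 0 <= P by apply: sumr_ge0 => k _; exact: is_norm_ge0.
rewrite !normrM norm_e !mul1r => le_max; have {le_max} PleS : P <= S.
  have := le_trans (ler_norm _) le_max; case: (ger0P (_ + S)) => _; lra.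
have slack0 : \sum_k (r (x k) - e * exchange (c k) k A) = 0.
  by rewrite big_split sumrN /= -/P -/S; lra.
have slack_ge0 k : true -> 0 <= r (x k) - e * exchange (c k) k A.
  by move=> _; rewrite subr_ge0.
have /eqP := slack0; rewrite psumr_eq0 // => /allP /(_ j).
rewrite mem_index_enum /= subr_eq0 => /(_ isT) /eqP rE.
by rewrite rE mulrA ee mul1r.
Qed.

End Maximizers.

(** * The volume of a unit ball is positive and finite *)

Section Volume.
Variable R : realType.

(** The integral of a nonnegative function is a supremum over the simple
    functions below it, hence monotone for arbitrary functions, such as the
    volumes of the sections of a set. *)
Lemma ge0_le_integral_setT d (T : measurableType d)
    (mu : {measure set T -> \bar R}) (f g : T -> \bar R) :
  (forall x, 0 <= f x)%E -> (forall x, f x <= g x)%E ->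
  (\int[mu]_x f x <= \int[mu]_x g x)%E.
Proof.
move=> f0 fg; rewrite !ge0_integralTE // => [|x]; last exact: le_trans (fg x).
apply: le_ereal_sup => _ [h /= hf <-]; exists h => //= x.
exact: le_trans (hf x) (fg x).
Qed.

Lemma lebesgue_tuple_ge0 n (A : set (n.-tuple (measurableTypeR R))) :
  (0 <= lebesgue_tuple A)%E.
Proof.
elim: n A => [|n IHn] A /=; first by rewrite diracE lee_fin.
by apply: integral_ge0 => x _ /=.
Qed.

Lemma le_lebesgue_tuple n (A B : set (n.-tuple (measurableTypeR R))) :
  A `<=` B -> (lebesgue_tuple A <= lebesgue_tuple B)%E.
Proof.
elim: n A B => [|n IHn] A B AB /=.
  rewrite !diracE lee_fin ler_nat.
  by case: (boolP (_ \in A)) => // /set_mem /AB /mem_set ->.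
apply: ge0_le_integral_setT => x /=; first exact: lebesgue_tuple_ge0.
by apply: IHn => t; rewrite /xsection /= !inE /=; exact: AB.
Qed.

Lemma lebesgue_tuple0 n :
  lebesgue_tuple (set0 : set (n.-tuple (measurableTypeR R))) = 0%E.
Proof.
elim: n => [|n IHn] /=; first by rewrite diracE memNset.
rewrite /product_measure1 integral0_eq // => x _ /=.
rewrite -IHn; congr lebesgue_tuple.
by apply/seteqP; split=> t //=; rewrite /xsection /= inE.
Qed.

Definition tuple_box n (a : R) : set (n.-tuple (measurableTypeR R)) :=
  [set t | forall i, - a <= tnth t i <= a].

Lemma lebesgue_tuple_box n (a : R) : 0 < a ->
  lebesgue_tuple (@tuple_box n a) = ((2 * a) ^+ n)%:E.
Proof.
move=> a0; elim: n => [|n IHn] /=.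
  by rewrite diracE mem_set // => -[].
pose I : set (measurableTypeR R) := [set` `[- a, a]].
have mI : measurable I by exact: measurable_itv.
have LI : lebesgue_measure I = (2 * a)%:E.
  rewrite (lebesgue_measure_itv `[- a, a]) /= lte_fin (_ : - a < a); last lra.
  by rewrite -EFinD opprK mulr_natl mulr2n.
rewrite /product_measure1 (eq_integral (fun x => ((2 * a) ^+ n)%:E * (\1_I x)%:E)%E).
  rewrite ge0_integralZl //; last 2 first.
    exact/measurable_EFinP/measurable_indic.
    by rewrite lee_fin exprn_ge0 // mulr_ge0 // ltW.
  rewrite integral_indic // setIT exprSr EFinM; congr (_ * _)%E; exact: LI.
move=> x _ /=; rewrite indicE.
have [/set_mem Ix|/negP nIx] := boolP (x \in I).
  rewrite mule1 -IHn; congr lebesgue_tuple; apply/seteqP; split=> t;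
    rewrite /xsection /= inE /= => bt i.
    by have := bt (lift ord0 i); rewrite tnthS.
  case: (unliftP ord0 i) => [k ->|->]; first by rewrite tnthS.
  by rewrite tnth0; move: Ix; rewrite /I /= in_itv.
rewrite mule0 (_ : xsection _ _ = set0); last first.
  apply/seteqP; split=> t //; rewrite /xsection /= inE /= => /(_ ord0).
  by rewrite tnth0 => bx; apply: nIx; apply/mem_set; rewrite /I /= in_itv.
exact: lebesgue_tuple0.
Qed.

(** The unit ball contains a box and is contained in one. *)
Lemma ball_volume_gt0 n (r : 'cV[R]_n -> R) : is_norm r -> 0 < ball_volume r.
Proof.
move=> rn; have [t t0 ht] := is_norm_lower_bound rn.
pose C := 1 + \sum_i r (delta_mx i 0).
have sum_ge0 : 0 <= \sum_i r (delta_mx i 0).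
  by apply: sumr_ge0 => i _; exact: is_norm_ge0.
have C0 : 0 < C by rewrite /C; lra.
have iC0 : 0 < C^-1 by rewrite invr_gt0.
have it0 : 0 < t^-1 by rewrite invr_gt0.
set U := [set s : n.-tuple (measurableTypeR R) |
            unit_ball r (\col_(i < n) tnth s i)].
have UE : ball_volume r = fine (lebesgue_tuple U) by [].
have lowU : @tuple_box n C^-1 `<=` U.
  move=> s bs; rewrite /U /unit_ball /=.
  apply: le_trans (is_norm_le_sum_coord rn _) _.
  have : (\sum_i r (delta_mx i 0)) * C^-1 <= 1.
    by rewrite ler_pdivrMr // mul1r /C; lra.
  apply: le_trans; rewrite mulr_suml; apply: ler_sum => i _.
  by rewrite ler_wpM2l ?is_norm_ge0 // mxE ler_norml; exact: bs.
have upU : U `<=` @tuple_box n t^-1.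
  move=> s; rewrite /U /unit_ball /= => Us i.
  rewrite -ler_norml -[_^-1]mulr1 ler_pdivlMl //.
  by have := le_trans (ht _ i) Us; rewrite mxE.
have := le_lebesgue_tuple lowU; have := le_lebesgue_tuple upU.
rewrite !lebesgue_tuple_box // UE.
case: (lebesgue_tuple U) => [v| |] //=; rewrite ?lee_fin // => _.
by apply: lt_le_trans; rewrite exprn_gt0 // mulr_gt0.
Qed.

End Volume.

(** * Extreme points of a convex hull *)

Section Transfer.
Variables (R : realType) (J : finType).
Local Notation V := {ffun J -> R^o}.

(** The set C of points that are lexicographically at most z, for the linear form
    l and then for the Euclidean norm, is convex and contains S1, hence the
    common hull and S2. Strict convexity of the Euclidean norm makes z an
    extreme point of C, so C without z is still convex; if z were not in S2,
    that smaller set would contain the hull. *)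
Lemma lex_max_transfer (S1 S2 : set V) (l z : V) :
  conv_hull S1 = conv_hull S2 -> S1 z ->
  (forall w, S1 w -> pairing l w <= pairing l z) ->
  (forall w, S1 w -> pairing l w = pairing l z ->
     pairing w w <= pairing z z) ->
  S2 z /\ forall w, S2 w -> pairing l w <= pairing l z.
Proof.
move=> eqS S1z lmax sqmax.
pose C : set V := [set w | pairing l w < pairing l z \/
  pairing l w = pairing l z /\ pairing w w <= pairing z z].
have lC w : C w -> pairing l w <= pairing l z.
  by case=> [/ltW //|[-> _]].
have S1C : S1 `<=` C.
  move=> w S1w; have := lmax w S1w; rewrite le_eqVlt => /predU1P[lw|]; last by left.
  by right; split=> //; exact: sqmax.
have C_conv (t : R) x y : 0 < t -> t < 1 -> C x -> C y ->
    let w := t *: x + (1 - t) *: y in C w /\ (w = z -> x = z).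
  move=> t0 t1 Cx Cy w.
  have lw : pairing l w = t * pairing l x + (1 - t) * pairing l y.
    by rewrite /w pairingDr !pairingZr.
  have lx := lC _ Cx; have ly := lC _ Cy.
  have t1' : 0 < 1 - t by lra.
  have lx' : t * pairing l x <= t * pairing l z by rewrite ler_pM2l.
  have ly' : (1 - t) * pairing l y <= (1 - t) * pairing l z by rewrite ler_pM2l.
  have lwz : pairing l w <= pairing l z by rewrite lw; lra.
  have [wlt|lwge] := ltP (pairing l w) (pairing l z).
    by split=> [|wz]; [left | move: wlt; rewrite wz ltxx].
  have lxz : pairing l x = pairing l z.
    apply/eqP; rewrite eq_le lx /= -(ler_pM2l t0); lra.
  have lyz : pairing l y = pairing l z.
    apply/eqP; rewrite eq_le ly /= -(ler_pM2l t1'); lra.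
  have sx : pairing x x <= pairing z z.
    by case: Cx => [|[]//]; rewrite lxz ltxx.
  have sy : pairing y y <= pairing z z.
    by case: Cy => [|[]//]; rewrite lyz ltxx.
  have sx' : t * pairing x x <= t * pairing z z by rewrite ler_pM2l.
  have sy' : (1 - t) * pairing y y <= (1 - t) * pairing z z by rewrite ler_pM2l.
  have tt0 : 0 < t * (1 - t) by rewrite mulr_gt0.
  have gap : pairing w w + t * (1 - t) * pairing (x - y) (x - y) <= pairing z z.
    by rewrite /w pairing_conv; lra.
  have xy0 : 0 <= t * (1 - t) * pairing (x - y) (x - y).
    by rewrite mulr_ge0 ?pairing_ge0 // ltW.
  split=> [|wz]; first by right; split; [apply/eqP; rewrite eq_le lwz | lra].
  have : pairing (x - y) (x - y) = 0.
    apply/eqP; rewrite eq_le pairing_ge0 andbT -(ler_pM2l tt0) mulr0.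
    by rewrite wz in gap; lra.
  move/pairing_eq0/eqP; rewrite subr_eq0 => /eqP xy.
  by rewrite -wz /w xy -scalerDl addrC subrK scale1r.
have convC : @convex_set R V C.
  apply/convex_setW => x y /set_mem Cx /set_mem Cy k k0 k1.
  by apply/mem_set; have [] := C_conv _ _ _ k0 k1 Cx Cy.
have convCz : @convex_set R V (C `\ z).
  apply/convex_setW => x y /set_mem [Cx /= xz] /set_mem [Cy _] k k0 k1.
  apply/mem_set; have [Cw wz] := C_conv _ _ _ k0 k1 Cx Cy.
  by split=> // /wz.
have S2C : S2 `<=` C.
  apply: subset_trans (sub_smallest (C := @convex_set R V) (subset_refl (A := S2))) _.
  by rewrite -/(conv_hull S2) -eqS; exact: smallest_sub.
split=> [|w /S2C]; last exact: lC.
apply: contrapT => nS2z.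
have : conv_hull S2 `<=` C `\ z.
  apply: smallest_sub => // w S2w; split; first exact: S2C.
  by move=> /= wz; apply: nS2z; rewrite -wz.
rewrite -eqS => /(_ z) [|_ /=]; last by apply.
exact: (sub_smallest (C := @convex_set R V) (subset_refl (A := S1))).
Qed.

End Transfer.

(** * Matching two norms with the same hulls *)

Section Match.
Variables (R : realType) (n : nat).

Lemma R_setP N (r : 'cV[R]_n -> R) z :
  R_set N r z <-> exists A : 'M[R]_(N, n), exists b : bool,
    contraction r A /\ z = ((-1) ^+ b * ball_volume r) *: minors A.
Proof.
split=> [[A cA [->|->]]|[A [[] [cA ->]]]].
- by exists A, false; rewrite expr0 mul1r.
- by exists A, true; rewrite expr1 mulN1r scaleNr.
- by exists A => //; right; rewrite expr1 mulN1r scaleNr.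
- by exists A => //; left; rewrite expr0 mul1r.
Qed.

Lemma continuous_minor N (I : incr_index n N) :
  continuous (fun A : 'M[R]_(N, n) => (minors A I : R)).
Proof.
under eq_fun => A do rewrite ffunE.
by apply: continuous_det => i j; under eq_fun => A do rewrite mxE;
   exact: coord_continuous.
Qed.

Lemma continuous_pairing_minors N
    (l : 'M[R]_(N, n) -> {ffun incr_index n N -> R^o}) :
  (forall I, continuous (fun A => (l A I : R))) ->
  continuous (fun A => pairing (l A) (minors A)).
Proof.
move=> cl; apply: continuous_bigsum => I.
by apply: continuous_mul; [exact: cl | exact: continuous_minor].
Qed.

(** The sign of z makes the linear form l equal to v_p |Phi| there; maximality of
    |Phi| at B among q-contractions is maximality of l at z on the common
    hull. *)
Lemma common_maximizer M (p q : 'cV[R]_n -> R) (L : R) (c : 'I_M -> 'cV[R]_n) :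
  is_norm p -> is_norm q -> K_set (n + M) p = K_set (n + M) q ->
  exists A B k, [/\ is_maximizer p L c A, is_maximizer q L c B &
    minors A = k *: minors B].
Proof.
move=> pn qn eqK; have vp := ball_volume_gt0 pn; have vq := ball_volume_gt0 qn.
have [l hl] := minor_functional_test L c.
have [A [cA Amax Alex]] := compact_lex_max
  (ex_intro _ _ (contraction0 pn (n + M)) : [set A | contraction p A] !=set0)
  (@compact_contraction R n p pn (n + M))
  (f := fun A => `|pairing l (minors A)|)
  (g := fun A => pairing (minors A) (minors A))
  (continuous_abs (continuous_pairing_minors (l := fun=> l)
    (fun I => @continuous_const R _ (l I))))
  (continuous_pairing_minors (@continuous_minor (n + M))).
have sgn_abs (b : bool) (u : R) : (-1) ^+ b * u <= `|u|.
  by apply: le_trans (ler_norm _) _; rewrite normrM normrX normrN1 expr1n mul1r.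
pose b := pairing l (minors A) < 0.
pose z := ((-1) ^+ b * ball_volume p) *: minors A.
have lz : pairing l z = ball_volume p * `|pairing l (minors A)|.
  by rewrite pairingZr mulrAC mulrC normrEsign.
have [|||] := lex_max_transfer (l := l) (z := z) eqK.
- by apply/R_setP; exists A, b.
- move=> w /R_setP[B [b' [cB ->]]].
  rewrite lz pairingZr mulrAC mulrC ler_pM2l //.
  exact: le_trans (sgn_abs _ _) (Amax _ cB).
- move=> w /R_setP[B [b' [cB ->]]].
  rewrite lz pairingZr mulrAC mulrC => /(mulfI (lt0r_neq0 vp)) eqB.
  have sq (s : bool) (m : {ffun incr_index n (n + M) -> R^o}) :
      pairing (((-1) ^+ s * ball_volume p) *: m)
        (((-1) ^+ s * ball_volume p) *: m) = ball_volume p ^+ 2 * pairing m m.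
    by rewrite pairingZr pairingZl mulrA -expr2 exprMn sqrr_sign mul1r.
  rewrite /z !sq ler_pM2l ?exprn_gt0 //; apply: Alex => //.
  by apply/eqP; rewrite eq_le Amax // -eqB sgn_abs.
move/R_setP => [B [b' [cB zB]]] qmax.
have vpz : (-1) ^+ b * ball_volume p != 0.
  by rewrite mulf_neq0 ?signr_eq0 // gt_eqF.
exists A, B, (((-1) ^+ b * ball_volume p)^-1 * ((-1) ^+ b' * ball_volume q)).
split; last 1 first.
- by rewrite -scalerA -zB /z scalerA mulVf // scale1r.
- by split=> // D cD; rewrite !hl; exact: Amax.
split=> // D cD; rewrite !hl -(ler_pM2l vq).
have /qmax : R_set (n + M) q
    (((-1) ^+ (pairing l (minors D) < 0)%R * ball_volume q) *: minors D).
  by apply/R_setP; exists D, (pairing l (minors D) < 0).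
rewrite pairingZr mulrAC mulrC -(normrEsign (pairing l (minors D))) => /le_trans; apply.
by rewrite zB pairingZr mulrAC mulrC ler_pM2l.
Qed.

(** The vectors of minors of A and B are proportional, so the ratio of det F to
    det G is also the ratio of the exchange terms, whose absolute values are the
    norms below. The lower bounds on the determinants do not involve c, as the
    compactness argument requires. *)
Lemma finite_match M (p q : 'cV[R]_n -> R) (c : 'I_M -> 'cV[R]_n)
    (Fp Fq : 'M[R]_n) :
  is_norm p -> is_norm q -> K_set (n + M) p = K_set (n + M) q ->
  contraction p Fp -> contraction q Fq -> 0 < `|\det Fp| -> 0 < `|\det Fq| ->
  exists F G : 'M[R]_n,
    [/\ contraction p F /\ contraction q G,
        `|\det Fp| / 2 <= `|\det F|, `|\det Fq| / 2 <= `|\det G| &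
        forall j, p (\adj F *m c j) * `|\det G| = q (\adj G *m c j) * `|\det F|].
Proof.
move=> pn qn eqK cFp cFq dp0 dq0.
have bound (r : 'cV[R]_n -> R) (d : R) : is_norm r -> 0 < d ->
    (* Stated for all larger L', since p and q have to share one constant. *)
    exists2 L : R, 0 < L & forall L', L <= L' ->
      forall F : 'M[R]_n, contraction r F ->
        \sum_j r (\adj F *m c j) <= L' * (d / 2).
  move=> rn d0.
  have cS : continuous (fun F : 'M[R]_n => \sum_j r (\adj F *m c j)).
    apply: continuous_bigsum => j; apply: is_norm_continuous => //.
    apply: continuous_mulmx => [|k l]; last exact: continuous_const.
    exact/continuous_adj/continuous_entries_id.
  have [F0 _ F0max] := compact_max
    (ex_intro _ _ (contraction0 rn n) : [set F : 'M[R]_n | contraction r F] !=set0)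
    (@compact_contraction R n r rn n) cS.
  set b := \sum_j _ in F0max.
  have b0 : 0 <= b by apply: sumr_ge0 => j _; exact: is_norm_ge0.
  have d2 : 0 < d / 2 by rewrite divr_gt0.
  have q0 : 0 <= b / (d / 2) by rewrite divr_ge0 // ltW.
  exists (1 + b / (d / 2)) => [|L' LL' F cF]; first by lra.
  apply: le_trans (F0max F cF) _; rewrite -ler_pdivrMr //; lra.
have [Lp Lp0 hLp] := bound _ _ pn dp0; have [Lq Lq0 hLq] := bound _ _ qn dq0.
have L0 : 0 < Lp + Lq by lra.
have {}hLp := hLp (Lp + Lq) ltac:(lra).
have {}hLq := hLq (Lp + Lq) ltac:(lra).
have [A [B [k [maxA maxB AB]]]] := common_maximizer (Lp + Lq) c pn qn eqK.
have detA := maximizer_det pn cFp L0 (lexx _) hLp maxA.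
have detB := maximizer_det qn cFq L0 (lexx _) hLq maxB.
exists (usubmx A), (usubmx B); split=> [|//|//|j].
  by split; apply: contraction_top => //; [case: maxA | case: maxB].
have detAB : \det (usubmx A) = k * \det (usubmx B).
  exact: (minor_functional_prop (minor_functional_top R n M) AB).
have dA0 : 0 < `|\det (usubmx A)|.
  by apply: lt_le_trans detA; rewrite divr_gt0.
have dB0 : 0 < `|\det (usubmx B)|.
  by apply: lt_le_trans detB; rewrite divr_gt0.
have := minor_functional_prop (minor_functional_exchange (c j) j) AB.
rewrite (maximizer_exchange pn cFp dp0 L0 (lexx _) hLp j maxA).
rewrite (maximizer_exchange qn cFq dq0 L0 (lexx _) hLq j maxB).
move/(congr1 Num.norm); rewrite !normrM !normr_sg -!normr_gt0 dA0 dB0 !mul1r.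
rewrite (ger0_norm (is_norm_ge0 pn _)) (ger0_norm (is_norm_ge0 qn _)) => ->.
by rewrite detAB normrM; ring.
Qed.

End Match.

Theorem theorem7p1 (R : realType) (n : nat) (n_ge1 : (1 <= n)%N)
    (p q : 'cV[R]_n -> R) (p_norm : is_norm p) (q_norm : is_norm q)
    (eqK : forall N : nat, (n <= N)%N -> K_set N p = K_set N q) :
  exists L : {linear 'cV[R]_n -> 'cV[R]_n},
    linear_isometry p q L /\ range L = [set: 'cV[R]_n].
Proof.
have [tp tp0 cFp] := contraction_scalar p_norm.
have [tq tq0 cFq] := contraction_scalar q_norm.
have det_scalar_gt0 (t : R) : 0 < t -> 0 < `|\det (t%:M : 'M[R]_n)|.
  by move=> t0; rewrite normr_gt0 det_scalar expf_neq0 // gt_eqF.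
have dp0 := det_scalar_gt0 _ tp0; have dq0 := det_scalar_gt0 _ tq0.
set dp := `|_| in dp0; set dq := `|_| in dq0.
pose T : topologicalType := ('M[R]_n * 'M[R]_n)%type.
pose Kp := [set F : 'M[R]_n | contraction p F] `&` [set F | dp / 2 <= `|\det F|].
pose Kq := [set F : 'M[R]_n | contraction q F] `&` [set F | dq / 2 <= `|\det F|].
have cdet : continuous (fun F : 'M[R]_n => `|\det F|).
  exact/continuous_abs/continuous_det/continuous_entries_id.
have cK : compact (Kp `*` Kq : set T).
  apply: compact_setX; apply: compact_closedI; try exact: compact_contraction;
    by apply: closed_le_continuous => //; exact: continuous_const.
(* The adjugates make the condition p (F^-1 c) = q (G^-1 c) closed. *)
pose E (c : 'cV[R]_n) : set T :=
  [set FG | p (\adj FG.1 *m c) * `|\det FG.2| = q (\adj FG.2 *m c) * `|\det FG.1|].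
have c1 : continuous_entries (fun FG : T => FG.1 : 'M[R]_n).
  move=> i j x; apply: (@continuous_comp _ _ _ (fun FG : T => FG.1)
    (fun F : 'M[R]_n => F i j)); [exact: cvg_fst | exact: coord_continuous].
have c2 : continuous_entries (fun FG : T => FG.2 : 'M[R]_n).
  move=> i j x; apply: (@continuous_comp _ _ _ (fun FG : T => FG.2)
    (fun F : 'M[R]_n => F i j)); [exact: cvg_snd | exact: coord_continuous].
have Ecl c : closed (E c).
  by apply: closed_eq_continuous; apply: continuous_mul;
    do ?[exact/continuous_abs/continuous_det];
    apply: is_norm_continuous => //; apply: continuous_mulmx => [|k l];
    do ?[exact: continuous_adj | exact: continuous_const].
have [s|[F G] [[_ /= dF] [_ /= dG]] FG] := compact_finite_intersection cK Ecl.
  have [F [G [[cF cG] dF dG FG]]] :=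
    finite_match (tnth (in_tuple s)) p_norm q_norm (eqK _ (leq_addr _ _))
      cFp cFq dp0 dq0.
  exists (F, G) => [|c cs]; first by split; split.
  have /tnthP [j ->] : c \in in_tuple s by [].
  exact: FG.
have dF0 : 0 < `|\det F| by apply: lt_le_trans dF; rewrite divr_gt0.
have dG0 : 0 < `|\det G| by apply: lt_le_trans dG; rewrite divr_gt0.
have detF : \det F != 0 by rewrite -normr_gt0.
have detG : \det G != 0 by rewrite -normr_gt0.
have uF : F \in unitmx by rewrite unitmxE unitfE.
have uG : G \in unitmx by rewrite unitmxE unitfE.
pose L : {linear 'cV[R]_n -> 'cV[R]_n} := mulmx (invmx G *m F).
exists L; split=> [x|]; last first.
  apply/seteqP; split=> // y _; exists (invmx F *m (G *m y)) => //.
  by rewrite /L /= -mulmxA mulKVmx // mulKmx.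
have /= := FG (F *m x).
rewrite /E /= mulmxA mul_adj_mx mul_scalar_mx is_norm_homog //.
have -> : \adj G *m (F *m x) = \det G *: L x.
  by rewrite /L /= /invmx uG -mulmxA -scalemxAl scalerA divff // scale1r.
rewrite is_norm_homog // => eq_pq.
apply: (mulfI (lt0r_neq0 dF0)); apply: (mulfI (lt0r_neq0 dG0)).
by move: eq_pq; rewrite /=; lra.
Qed.
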